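(* Let $v\in V_\tau$. Then there exists a triple $(T_1,\pi,T_2)$ representing $v$, where: (1) $T_1$ and $T_2$ are trees with the same number of leaves, $k$ say; (2) $\pi\in\mathcal S_k$; (3) $T_2$ is a tree consisting entirely of $x$-carets; (4) the only $y$-carets in $T_1$ have no left children (that is, the left leg of every $y$-caret of $T_1$ ends in a leaf of $T_1$).
   Context: Let $\tau=(\sqrt5-1)/2$, so $1=\tau+\tau^2$. $V_\tau$ is the group (under composition, $fg=f\circ g$) of left-continuous piecewise-linear bijections of $(0,1]$ with finitely many breakpoints (including discontinuities), all in $\mathbb Z[\tau]$, and all slopes integer powers of $\tau$. An $x$-caret subdivides an interval $(a,a+L]$ into $(a,a+\tau^2L]$ and $(a+\tau^2L,a+L]$; a $y$-caret subdivides it into $(a,a+\tau L]$ and $(a+\tau L,a+L]$. A tree is a finite rooted binary tree whose interior nodes (carets) are each of type $x$ or $y$; with root $(0,1]$, its leaves, ordered from left to right, give a subdivision of $(0,1]$. $\mathcal S_k$ is the symmetric group on the $k$ leaf positions. A triple $(T_1,\pi,T_2)$, with $T_1,T_2$ trees with $k$ leaves and $\pi\in\mathcal S_k$, represents the element of $V_\tau$ mapping the interval of leaf $i$ of $T_2$ affinely and increasingly onto the interval of leaf $\pi(i)$ of $T_1$. *)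

(* Defs.v *)
From HB Require Import structures.
From mathcomp Require Import all_boot all_order all_algebra all_fingroup.
From mathcomp Require Import all_classical all_reals all_analysis.
Set Implicit Arguments.
Unset Strict Implicit.
Unset Printing Implicit Defensive.
Import Order.TTheory GRing.Theory Num.Theory.
Import numFieldNormedType.Exports.
Local Open Scope classical_set_scope.
Local Open Scope ring_scope.

Definition tau (R : realType) : R := (Num.sqrt 5 - 1) / 2.

(* Z[tau], as the image of the evaluation at tau of integer polynomials. *)
Definition Ztau (R : realType) : set R :=
  [set x | exists p : {poly int}, x = (map_poly intr p).[tau R]].

(* The points of [0 :: s] increase from 0 to 1 and include all the breakpoints.
   Affineness is only required strictly between two of them: in Vtau the value
   at the right end of each piece is determined by left continuity. *)
Definition piecewise_linear_tau (R : realType) (f : R -> R) : Prop :=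
  exists s : seq R,
    [/\ path <%R 0 s, last 0 s = 1, (forall b, b \in s -> Ztau b) &
        forall i : nat, (i < size s)%N ->
          exists (n : int) (c : R), forall x : R,
            nth 0 (0 :: s) i < x < nth 0 (0 :: s) i.+1 ->
            f x = tau R ^ n * x + c].

(* A self-map of (0,1] is given by a function on R of which only the values on
   (0,1] matter: every clause below depends on these values alone. *)
Definition Vtau (R : realType) : set (R -> R) :=
  [set f : R -> R | [/\ set_bij `]0, 1] `]0, 1] f,
               (forall t : R, 0 < t <= 1 -> f x @[x --> t^'-] --> f t) &
               piecewise_linear_tau f]].

Inductive caret := Xcaret | Ycaret.

Inductive tree := Leaf | Node of caret & tree & tree.

Fixpoint nleaves (T : tree) : nat :=
  if T is Node _ l r then (nleaves l + nleaves r)%N else 1%N.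

(* The leaf intervals of T, from left to right, when the root of T is
   (a, a + L]; the pair (a, L) stands for the interval (a, a + L]. *)
Fixpoint leaves (R : realType) (a L : R) (T : tree) : seq (R * R) :=
  match T with
  | Leaf => [:: (a, L)]
  | Node Xcaret l r =>
      leaves a (tau R ^+ 2 * L) l ++ leaves (a + tau R ^+ 2 * L) (tau R * L) r
  | Node Ycaret l r =>
      leaves a (tau R * L) l ++ leaves (a + tau R * L) (tau R ^+ 2 * L) r
  end.

Definition leaf_interval (R : realType) (T : tree) (i : nat) : set R :=
  let: (a, L) := nth (0, 0) (leaves 0 1 T) i in `]a, (a + L)].

Definition incr_affine_onto (R : realType) (f : R -> R) (I J : set R) : Prop :=
  (exists m c : R, 0 < m /\ forall x, I x -> f x = m * x + c) /\ f @` I = J.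

(* Only meaningful when T1 and T2 both have exactly k leaves. *)
Definition represents (R : realType) (k : nat) (T1 : tree) (p : 'S_k)
    (T2 : tree) (f : R -> R) : Prop :=
  forall i : 'I_k,
    incr_affine_onto f (@leaf_interval R T2 i) (@leaf_interval R T1 (p i)).

Fixpoint only_x (T : tree) : Prop :=
  if T is Node c l r then [/\ c = Xcaret, only_x l & only_x r] else True.

Fixpoint y_left_leaf (T : tree) : Prop :=
  if T is Node c l r then
    [/\ c = Ycaret -> l = Leaf, y_left_leaf l & y_left_leaf r]
  else True.

(* Main.v *)
Require Import Defs.
From mathcomp Require Import all_boot all_order all_algebra all_fingroup.
From mathcomp Require Import all_classical all_reals all_analysis.
From mathcomp Require Import zify ring lra.

(** Call a tree made of x-carets an x-tree, and record an interval of length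
    [tau ^ e] by its exponent [e]. A subdivision of (0,1] into such intervals
    is then a word of exponents whose weight, the sum of the [tau ^ e], is 1.

    Domain side. Every point of Z[tau] inside (0,1) becomes an endpoint of a
    leaf of some x-tree: descending into the half of the x-caret that contains
    the point and rescaling that half to (0,1] shrinks the coefficient of
    [tau] in the point until the point is [tau ^ 2] or [tau] ([avoid_point]).
    So some x-tree has no breakpoint of [v] inside any leaf ([avoid_all]), and
    [v] is affine on each leaf, with image an interval whose length is a power
    of [tau] ([Vtau_x_tree]). These images partition (0,1], hence, read from
    left to right, they form a word of weight 1 ([partition_place]).

    Range side. It remains to refine, by x-trees, any word [w] of weight 1 into
    the leaves of a tree whose y-carets have a leaf on the left
    ([refines_y_left_leaf]); grafting the same x-trees on the domain side then
    gives T2. Splitting all the longest intervals repeatedly turns [w] into a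
    word in two letters [m], [m.+1]. Because [tau] is irrational, the weight
    determines how often each letter occurs, so [w] has become a permutation of
    the leaves of the x-tree obtained by the same splittings from (0,1] itself.
    A permutation is a sequence of adjacent transpositions of a long and a
    short interval. After a few more splittings the two orders of such a pair
    differ only in the order of their first two pieces, and these pieces form a
    single caret of the first interval; so the transposition can be undone by
    turning this x-caret into a y-caret ([swap_long_short], [swap_short_long]).
    Thus [w] refines to the leaves of some tree. Finally, y-carets are pushed
    down with the relations y(y(A,B),C) = x(A,x(B,C)) and
    y(x(A,x(B,C)),D) = x(y(A,B),x(C,D)) until their left children are leaves
    ([y_left_leaf_refinement]). *)

Set Implicit Arguments.
Unset Strict Implicit.
Unset Printing Implicit Defensive.
Import Order.TTheory GRing.Theory Num.Theory.
Import numFieldNormedType.Exports.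

(** * Words of exponents and their refinements *)

(** The leaves of [T] have lengths [tau ^ e] for [e] in this word when the root
    has length [tau ^ d]. Exponents keep the combinatorics free of real numbers,
    and the positions of the leaves can be recovered by [place] below. *)
Fixpoint exps (d : nat) (T : tree) : seq nat :=
  match T with
  | Leaf => [:: d]
  | Node Xcaret l r => exps d.+2 l ++ exps d.+1 r
  | Node Ycaret l r => exps d.+1 l ++ exps d.+2 r
  end.

Lemma size_exps d T : size (exps d T) = nleaves T.
Proof. by elim: T d => [|[] l IHl r IHr] d //=; rewrite size_cat IHl IHr. Qed.

Fixpoint refine (w : seq nat) (Xs : seq tree) : seq nat :=
  match w, Xs with
  | n :: w', X :: Xs' => exps n X ++ refine w' Xs'
  | _, _ => [::]
  end.

Fixpoint Forall_trees (P : tree -> Prop) (Xs : seq tree) : Prop :=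
  if Xs is X :: Xs' then P X /\ Forall_trees P Xs' else True.

Definition refines (P : tree -> Prop) (w w' : seq nat) : Prop :=
  exists Xs, [/\ size Xs = size w, Forall_trees P Xs & w' = refine w Xs].

Lemma Forall_trees_cat P Xs Ys :
  Forall_trees P (Xs ++ Ys) <-> Forall_trees P Xs /\ Forall_trees P Ys.
Proof. by elim: Xs => [|X Xs IH] /=; tauto. Qed.

Lemma refine_cat w1 w2 Xs1 Xs2 : size Xs1 = size w1 ->
  refine (w1 ++ w2) (Xs1 ++ Xs2) = refine w1 Xs1 ++ refine w2 Xs2.
Proof.
elim: w1 Xs1 => [|n w1 IH] [|X Xs1] //= [h].
by rewrite IH // catA.
Qed.

Lemma refines_cat P w1 w2 w1' w2' :
  refines P w1 w1' -> refines P w2 w2' -> refines P (w1 ++ w2) (w1' ++ w2').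
Proof.
move=> [Xs1 [s1 P1 ->]] [Xs2 [s2 P2 ->]]; exists (Xs1 ++ Xs2).
by rewrite !size_cat s1 s2 refine_cat //; split=> //; apply/Forall_trees_cat.
Qed.

Lemma refines1 (P : tree -> Prop) n X : P X -> refines P [:: n] (exps n X).
Proof. by move=> PX; exists [:: X]; rewrite /= cats0. Qed.

Lemma refines_id (P : tree -> Prop) w : P Leaf -> refines P w w.
Proof.
move=> PL; elim: w => [|n w IH]; first by exists [::].
exact: refines_cat (refines1 n PL) IH.
Qed.

Lemma graft T Xs : size Xs = nleaves T ->
  exists T', (forall d, exps d T' = refine (exps d T) Xs) /\
    (only_x T -> Forall_trees only_x Xs -> only_x T').
Proof.
elim: T Xs => [|c l IHl r IHr] Xs /=.
  case: Xs => [|X [|]] // _; exists X; split=> [d|_ []//]; by rewrite cats0.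
move=> sXs.
have sl : size (take (nleaves l) Xs) = nleaves l.
  by rewrite size_takel // sXs leq_addr.
have sr : size (drop (nleaves l) Xs) = nleaves r by rewrite size_drop sXs addKn.
have [l' [el xl]] := IHl _ sl; have [r' [er xr]] := IHr _ sr.
exists (Node c l' r'); rewrite -(cat_take_drop (nleaves l) Xs); split=> [d|].
  by case: c => /=; rewrite refine_cat ?size_exps // el er.
by move=> [-> ol or_] /Forall_trees_cat[fl fr]; split; auto.
Qed.

Lemma refines_exps P d T w : refines P (exps d T) w -> exists T', w = exps d T'.
Proof.
move=> [Xs [sz _ ->]]; rewrite size_exps in sz.
by have [T' [e _]] := graft sz; exists T'; rewrite e.
Qed.

(** Grafting x-trees on an x-tree gives an x-tree; this is what makes
    refinement by x-trees transitive. *)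
Lemma refines_exps_x n X w : only_x X -> refines only_x (exps n X) w ->
  exists2 Y, only_x Y & w = exps n Y.
Proof.
move=> xX [Xs [sz h ->]]; rewrite size_exps in sz.
by have [T' [e o]] := graft sz; exists T'; rewrite ?e //; apply: o.
Qed.

Lemma refines_split P w1 w2 w' : refines P (w1 ++ w2) w' ->
  exists w1' w2', [/\ refines P w1 w1', refines P w2 w2' & w' = w1' ++ w2'].
Proof.
move=> [Xs [sz h ->]]; rewrite size_cat in sz.
have sl : size (take (size w1) Xs) = size w1 by rewrite size_takel // sz leq_addr.
have sr : size (drop (size w1) Xs) = size w2 by rewrite size_drop sz addKn.
move: h; rewrite -(cat_take_drop (size w1) Xs) => /Forall_trees_cat[h1 h2].
rewrite refine_cat //; do 2 eexists; split; last reflexivity.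
  by exists (take (size w1) Xs).
by exists (drop (size w1) Xs).
Qed.

Lemma refines_trans_x w1 w2 w3 :
  refines only_x w1 w2 -> refines only_x w2 w3 -> refines only_x w1 w3.
Proof.
move=> [Xs [sz h ->]]; elim: w1 Xs sz h w3 => [|n w IH] [|X Xs] //= [sz] [hX h] w3.
move=> /refines_split[a [b [/(refines_exps_x hX)[Y oY ->] /(IH _ sz h) h2 ->]]].
by rewrite -cat1s; apply: refines_cat => //; exact: refines1.
Qed.

(** * Trees whose y-carets have a leaf on the left *)

Definition Xl := Node Xcaret Leaf Leaf.

(** A root y-caret already has a leaf on its left; splitting this leaf into
    three by two x-carets makes y(x(Leaf,x(Leaf,Leaf)),r) appear, which has the
    same leaves as x(y(Leaf,Leaf),x(Leaf,r)). *)
Lemma root_x d A : y_left_leaf A -> exists B C,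
  [/\ y_left_leaf B, y_left_leaf C & refines only_x (exps d A) (exps d (Node Xcaret B C))].
Proof.
case: A => [|[] l r] /=.
- by move=> _; exists Leaf, Leaf; split=> //=; exact: (@refines1 _ _ Xl).
- by move=> [_ ? ?]; exists l, r; split=> //; exact: refines_id.
move=> [/(_ erefl) -> _ hr] /=.
exists (Node Ycaret Leaf Leaf), (Node Xcaret Leaf r); split=> //=.
rewrite -[_ :: exps _ _]cat1s -[[:: _, _, _ & _]]/([:: d.+3; d.+4; d.+3] ++ exps d.+2 r).
apply: refines_cat; last exact: refines_id.
by apply: (@refines1 _ _ (Node Xcaret Leaf Xl)) => /=.
Qed.

(** If the left child [A] is a y-caret, then y(y(Leaf,A2),C) = x(Leaf,x(A2,C)).
    If it is x(A1,A2), refine [A2] to have an x-caret x(B1,B2) at its root and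
    use y(x(A1,x(B1,B2)),C) = x(y(A1,B1),x(B2,C)): the remaining y-caret has the
    smaller left child [A1]. *)
Lemma y_left_leaf_Y A C d : y_left_leaf A -> y_left_leaf C ->
  exists2 T, y_left_leaf T & refines only_x (exps d (Node Ycaret A C)) (exps d T).
Proof.
elim: A C d => [|[] A1 IH1 A2 _] C d /=.
- by move=> _ hC; exists (Node Ycaret Leaf C) => //=; exact: refines_id.
- move=> [_ h1 h2] hC.
  have [B1 [B2 [hB1 hB2 r2]]] := root_x d.+2 h2.
  have [T hT rT] := IH1 B1 d.+2 h1 hB1.
  exists (Node Xcaret T (Node Xcaret B2 C)) => //=.
  apply: (@refines_trans_x _ ((exps d.+3 A1 ++ exps d.+4 B1 ++ exps d.+3 B2) ++ exps d.+2 C)).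
    by apply: refines_cat; first apply: refines_cat => //; exact: refines_id.
  rewrite catA -catA; apply: refines_cat => //; exact: refines_id.
- move=> [/(_ erefl) -> _ h2] hC.
  exists (Node Xcaret Leaf (Node Xcaret A2 C)) => //=; exact: refines_id.
Qed.

Lemma y_left_leaf_refinement T d :
  exists2 T', y_left_leaf T' & refines only_x (exps d T) (exps d T').
Proof.
elim: T d => [|c l IHl r IHr] d; first by exists Leaf => //; exact: refines_id.
case: c.
  have [l' hl rl] := IHl d.+2; have [r' hr rr] := IHr d.+1.
  by exists (Node Xcaret l' r') => //=; exact: refines_cat.
have [l' hl rl] := IHl d.+1; have [r' hr rr] := IHr d.+2.
have [T' hT rT] := y_left_leaf_Y d hl hr.
by exists T' => //; apply: refines_trans_x rT => /=; exact: refines_cat.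
Qed.

(** * Realising a transposition by a y-caret *)

(** When [m] is the smallest exponent of [w], this splits all the longest
    intervals by an x-caret. *)
Definition step (m : nat) (w : seq nat) : seq nat :=
  flatten [seq if n == m then [:: m.+2; m.+1] else [:: n] | n <- w].

Fixpoint steps (m k : nat) (w : seq nat) : seq nat :=
  if k is k'.+1 then step (m + k') (steps m k' w) else w.

Lemma step_cat m w1 w2 : step m (w1 ++ w2) = step m w1 ++ step m w2.
Proof. by rewrite /step map_cat flatten_cat. Qed.

Lemma step_cons m n w :
  step m (n :: w) = (if n == m then [:: m.+2; m.+1] else [:: n]) ++ step m w.
Proof. by []. Qed.

Lemma steps_cat m k w1 w2 : steps m k (w1 ++ w2) = steps m k w1 ++ steps m k w2.
Proof. by elim: k => //= k ->; rewrite step_cat. Qed.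

Lemma steps_add m k j w : steps m (k + j) w = steps (m + k) j (steps m k w).
Proof. by elim: j => [|j IH]; rewrite ?addn0 // addnS /= IH addnA. Qed.

Lemma refines_step m w : refines only_x w (step m w).
Proof.
elim: w => [|n w IH]; first by exists [::].
rewrite step_cons -cat1s; apply: refines_cat => //.
case: eqP => [->|_]; first exact: (@refines1 _ _ Xl).
exact: refines_id.
Qed.

Lemma refines_steps m k w : refines only_x w (steps m k w).
Proof.
elim: k => [|k IH] /=; first exact: refines_id.
exact: refines_trans_x IH (refines_step _ _).
Qed.

(** This is an instance of the fact that the Fibonacci substitution
    L -> SL, S -> L preserves the difference between LS and SL up to its sign:
    LS becomes SLL and SL becomes LSL. *)
Lemma steps_swap m k : exists r,
  (steps m k [:: m; m.+1] = [:: (m + k)%N, (m + k).+1 & r] /\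
   steps m k [:: m.+1; m] = [:: (m + k).+1, (m + k)%N & r]) \/
  (steps m k [:: m; m.+1] = [:: (m + k).+1, (m + k)%N & r] /\
   steps m k [:: m.+1; m] = [:: (m + k)%N, (m + k).+1 & r]).
Proof.
have Sm j : (j.+1 == j) = false by lia.
elim: k => [|k [r IH]] /=; first by exists [::]; rewrite addn0; left.
rewrite addnS; exists [:: (m + k).+1 & step (m + k) r].
by case: IH => -[-> ->]; [right|left]; rewrite !step_cons eqxx Sm.
Qed.

(** After one step the swapped pair has exponents 1, 2 1 (relative to [m]),
    which are regrouped as 1 2 for the long interval, a y-caret, and 1 for the
    short one. *)
Lemma swap_long_short m : refines (fun=> True) [:: m; m.+1] (steps m 1 [:: m.+1; m]).
Proof.
exists [:: Node Ycaret Leaf Leaf; Leaf].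
split=> //; rewrite /= addn0.
by do !(rewrite step_cons; case: eqP => ?; try lia; rewrite /=).
Qed.

(** One step gives 2 1, 1, whose first piece does not belong to a caret of the
    short interval. After a second step the pieces 2 3 2, 3 2 are regrouped as
    2 3 for the short interval, a y-caret, and 2 3 2 for the long one. *)
Lemma swap_short_long m : refines (fun=> True) [:: m.+1; m] (steps m 2 [:: m; m.+1]).
Proof.
exists [:: Node Ycaret Leaf Leaf; Node Xcaret Leaf Xl].
split=> //; rewrite /= !addnS addn0.
by do !(rewrite step_cons; case: eqP => ?; try lia; rewrite /=).
Qed.

(** Allowing further steps makes the property stable under exchanging adjacent
    letters, while a word that is literally the leaves of a tree need not
    remain so. *)
Definition tree_like (m : nat) (w : seq nat) : Prop :=
  exists k T, steps m k w = exps 0 T.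

Lemma swap_leaves j m T u v A B :
  exps 0 T = u ++ A ++ v -> refines (fun=> True) A (steps m j B) ->
  exists T', steps m j (u ++ B ++ v) = exps 0 T'.
Proof.
move=> eT rAB; apply: (@refines_exps (fun=> True) 0 T); rewrite eT !steps_cat.
have weak w w' : refines only_x w w' -> refines (fun=> True) w w'.
  by move=> [Xs [? _ ->]]; exists Xs; split=> //; elim: (Xs).
by apply: refines_cat; [|apply: refines_cat] => //; apply: weak; exact: refines_steps.
Qed.

(** The long and the short letter of the pair that has to be exchanged in the
    leaves of the tree may come in either order, since each step reverses it;
    both cases are covered by the two lemmas on swaps. *)
Lemma tree_like_swap m u v a b : a \in [:: m; m.+1] -> b \in [:: m; m.+1] ->
  tree_like m (u ++ [:: a; b] ++ v) -> tree_like m (u ++ [:: b; a] ++ v).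
Proof.
have main A B : A = [:: m; m.+1] /\ B = [:: m.+1; m] \/ A = [:: m.+1; m] /\ B = [:: m; m.+1] ->
  tree_like m (u ++ A ++ v) -> tree_like m (u ++ B ++ v).
  move=> AB [k [T eT]].
  have [r hr] := steps_swap m k.
  have [] : exists r, (steps m k A = [:: (m + k)%N; (m + k).+1] ++ r /\
             steps m k B = [:: (m + k).+1; (m + k)%N] ++ r) \/
            (steps m k A = [:: (m + k).+1; (m + k)%N] ++ r /\
             steps m k B = [:: (m + k)%N; (m + k).+1] ++ r).
    by exists r => /=; case: AB => -[-> ->]; tauto.
  move=> {hr}r hr; move: eT; rewrite !steps_cat.
  case: hr => -[eA eB]; rewrite eA -catA => /esym eT.
    have [T' eT'] := swap_leaves eT (swap_long_short _).
    exists (k + 1), T'; rewrite steps_add -eT'.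
    by congr (steps _ _ _); rewrite !steps_cat eB -catA.
  have [T' eT'] := swap_leaves eT (swap_short_long _).
  exists (k + 2), T'; rewrite steps_add -eT'.
  by congr (steps _ _ _); rewrite !steps_cat eB -catA.
by rewrite !inE => /orP[] /eqP -> /orP[] /eqP -> //; apply: main; tauto.
Qed.

(** Adjacent transpositions generate all permutations; the letters are
    restricted by [D] because only intervals of consecutive sizes can be
    exchanged. *)
Lemma perm_adjacent (P : seq nat -> Prop) (D : pred nat) :
  (forall u v a b, D a -> D b -> P (u ++ [:: a; b] ++ v) -> P (u ++ [:: b; a] ++ v)) ->
  forall w w', perm_eq w w' -> all D w -> P w -> P w'.
Proof.
move=> swap.
have front w1 : forall u b w2, all D w1 -> D b ->
    P (u ++ w1 ++ b :: w2) -> P (u ++ b :: w1 ++ w2).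
  elim/last_ind: w1 => [//|w1 a IH] u b w2; rewrite all_rcons => /andP[Da Dw] Db h.
  rewrite cat_rcons; apply: IH => //; rewrite catA; apply: (swap _ w2 a b) => //.
  by rewrite -catA -cat_rcons.
suff gen w' : forall u w, perm_eq w w' -> all D w -> P (u ++ w) -> P (u ++ w').
  by move=> w w'; exact: (gen w' [::]).
elim: w' => [|b w' IH] u w pw; first by move/perm_nilP: pw => ->.
have /splitPr E : b \in w by rewrite (perm_mem pw) inE eqxx.
case: E pw => w1 w2; rewrite -cat1s perm_catCA perm_cons => pw.
rewrite all_cat /= => /and3P[D1 Db D2] h.
rewrite -cat1s catA; apply: (IH _ (w1 ++ w2)) => //; first by rewrite all_cat D1.
by rewrite -catA; exact: front.
Qed.

Local Open Scope classical_set_scope.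
Local Open Scope ring_scope.

(** * The arithmetic of tau, and words of weight 1 *)

Lemma tau_sq (R : realType) : tau R ^+ 2 = 1 - tau R.
Proof.
have h : Num.sqrt 5 ^+ 2 = 5 :> R by rewrite sqr_sqrtr // ler0n.
rewrite /tau; move: (Num.sqrt 5 : R) h => s h; nra.
Qed.

Lemma tau_bounds (R : realType) : 3/5 < tau R < 2/3.
Proof.
have h : Num.sqrt 5 ^+ 2 = 5 :> R by rewrite sqr_sqrtr // ler0n.
have h0 : 0 <= Num.sqrt 5 :> R by exact: sqrtr_ge0.
by rewrite /tau; move: (Num.sqrt 5 : R) h h0 => s h h0; nra.
Qed.

Lemma tau_gt0 (R : realType) : 0 < tau R.
Proof. have := tau_bounds R; lra. Qed.

Lemma tau_expSS (R : realType) n : tau R ^+ n.+2 + tau R ^+ n.+1 = tau R ^+ n.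
Proof. rewrite -addn2 exprD tau_sq exprS; ring. Qed.

(** The 5-adic valuation of a nonzero square is even. *)
Lemma square_not_5square (x y : nat) : (x ^ 2 = 5 * y ^ 2 -> y = 0)%N.
Proof.
move=> h; case: (posnP y) => // y0.
have x0 : (0 < x)%N by case: x h => //; case: y y0.
have := congr1 (logn 5) h; rewrite lognM ?expn_gt0 ?y0 // !lognX (@logn_prime 5 5) //=; lia.
Qed.

(** A relation [i + j tau = 0] makes the norm form [i^2 - i j - j^2] vanish, and
    four times this form is [(2 i - j)^2 - 5 j^2]. *)
Lemma tau_free (R : realType) (i j : int) :
  i%:~R + j%:~R * tau R = 0 -> i = 0 /\ j = 0.
Proof.
move=> h.
have e : i ^+ 2 - i * j - j ^+ 2 = 0.
  apply/eqP; rewrite -(intr_eq0 R) !(rmorphB, rmorphXn, rmorphM) /=.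
  have -> : i%:~R = - (j%:~R * tau R) by apply/eqP; rewrite -addr_eq0 h.
  apply/eqP; rewrite sqrrN exprMn tau_sq; ring.
have e2 : (2 * i - j) ^+ 2 = 5 * j ^+ 2 by lia.
have j0 : j = 0.
  apply/eqP; rewrite -absz_eq0; apply/eqP.
  apply: (@square_not_5square `|(2 * i - j)%R|%N).
  by have := congr1 absz e2; rewrite abszX abszM abszX.
by split=> //; move: e; rewrite j0; lia.
Qed.

Section Weight.
Variable R : realType.
Local Notation tau := (tau R).

Definition weight (w : seq nat) : R := \sum_(e <- w) tau ^+ e.

Lemma weight_cat w1 w2 : weight (w1 ++ w2) = weight w1 + weight w2.
Proof. by rewrite /weight big_cat. Qed.

Lemma weight_step m w : weight (step m w) = weight w.
Proof.
elim: w => [|n w IH] //; rewrite step_cons weight_cat IH /weight big_cons; congr (_ + _).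
by case: eqP => [->|_]; rewrite !big_cons big_nil addr0 // tau_expSS.
Qed.

Lemma weight_steps m k w : weight (steps m k w) = weight w.
Proof. by elim: k => //= k <-; rewrite weight_step. Qed.

Lemma steps_letters m w : all (fun n => n <= m.+1)%N w ->
  all (fun n => n \in [:: m; m.+1]) (steps 0 m w).
Proof.
move=> hw.
suff h k : (k <= m)%N -> all (fun n => k <= n <= m.+1)%N (steps 0 k w).
  apply: sub_all (h m (leqnn _)) => n; rewrite !inE; lia.
elim: k => [_|k IH km] //=.
rewrite add0n; have := IH (ltnW km); elim: (steps 0 k w) => [//|n s IHs] /= /andP[hn hs].
rewrite step_cons all_cat IHs // andbT; case: eqP => /= ?; lia.
Qed.

Lemma perm_two_letters m w : all (fun n => n \in [:: m; m.+1]) w ->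
  perm_eq w (nseq (count_mem m w) m ++ nseq (count_mem m.+1 w) m.+1).
Proof.
elim: w => [|n w IH] //= /andP[]; rewrite !inE => /orP[] /eqP -> /IH h.
  by rewrite eqxx (_ : (m == m.+1) = false) ?perm_cons //; lia.
rewrite eqxx (_ : (m.+1 == m) = false) ?add0n; last by lia.
by rewrite /= -(cat1s m.+1) -(cat1s m.+1 (nseq _ _)) perm_sym perm_catCA perm_cat2l perm_sym.
Qed.

Lemma weight_nseq k m : weight (nseq k m) = k%:R * tau ^+ m.
Proof.
rewrite /weight; elim: k => [|k IH] /=; first by rewrite big_nil mul0r.
by rewrite big_cons IH -natr1 mulrDl mul1r addrC.
Qed.

Lemma weight_two_letters m w : all (fun n => n \in [:: m; m.+1]) w ->
  weight w = ((count_mem m w)%:R + (count_mem m.+1 w)%:R * tau) * tau ^+ m.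
Proof.
move=> /perm_two_letters pw; rewrite /weight (perm_big _ pw) -/(weight _).
by rewrite weight_cat !weight_nseq exprS; ring.
Qed.

(** By irrationality of [tau] the weight determines the number of occurrences of
    each of the two letters. *)
Lemma perm_eq_weight m w w' :
  all (fun n => n \in [:: m; m.+1]) w -> all (fun n => n \in [:: m; m.+1]) w' ->
  weight w = weight w' -> perm_eq w w'.
Proof.
move=> hw hw' e.
have [h1 h2] : count_mem m w = count_mem m w' /\ count_mem m.+1 w = count_mem m.+1 w'.
  move: e; rewrite (weight_two_letters hw) (weight_two_letters hw').
  move/mulIf => /(_ (lt0r_neq0 (exprn_gt0 _ (tau_gt0 R)))) e.
  have [] := @tau_free R ((count_mem m w)%:Z - (count_mem m w')%:Z)
     ((count_mem m.+1 w)%:Z - (count_mem m.+1 w')%:Z); last by lia.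
  by rewrite !rmorphB /= -!pmulrn; move: e; lra.
by apply: (perm_trans (perm_two_letters hw)); rewrite h1 h2 perm_sym perm_two_letters.
Qed.

(** The same steps, applied to [w] and to the undivided interval, yield two words
    that are permutations of each other; the second is the word of an x-tree. *)
Theorem refines_y_left_leaf w : weight w = 1 ->
  exists2 T, y_left_leaf T & refines only_x w (exps 0 T).
Proof.
move=> w1.
pose m := (\max_(n <- w) n)%N.
have wm : all (fun n => n <= m.+1)%N w.
  by apply/allP => n nw; apply: leqW; rewrite /m (big_rem n) //= leq_maxl.
pose w0 := steps 0 m [:: 0%N].
have h0 : all (fun n => n \in [:: m; m.+1]) w0 by exact: steps_letters.
have hw := steps_letters wm.
have p : perm_eq w0 (steps 0 m w).
  by apply: (@perm_eq_weight m) => //; rewrite !weight_steps w1 /weight big_seq1.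
have t0 : tree_like m w0.
  have [T eT] := refines_exps (d := 0) (T := Leaf) (refines_steps 0 m [:: 0%N]).
  by exists 0%N, T.
have [k [T eT]] := perm_adjacent (@tree_like_swap m) p h0 t0.
have [T' hT' rT] := y_left_leaf_refinement T 0.
exists T' => //; apply: refines_trans_x (refines_steps 0 m w) _.
by apply: refines_trans_x (refines_steps m k _) _; rewrite eT.
Qed.
End Weight.

(** * Points of Z[tau] as endpoints of leaves *)

Section Points.
Variable R : realType.
Local Notation tau := (tau R).

Fixpoint place (a : R) (w : seq nat) : seq (R * R) :=
  if w is e :: w' then (a, tau ^+ e) :: place (a + tau ^+ e) w' else [::].

Lemma weight_cons e w : weight R (e :: w) = tau ^+ e + weight R w.
Proof. by rewrite /weight big_cons. Qed.

Lemma weight_exps d T : weight R (exps d T) = tau ^+ d.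
Proof.
elim: T d => [|[] l IHl r IHr] d /=; first by rewrite /weight big_seq1.
  by rewrite weight_cat IHl IHr tau_expSS.
by rewrite weight_cat IHl IHr addrC tau_expSS.
Qed.

Lemma place_cat a w1 w2 : place a (w1 ++ w2) = place a w1 ++ place (a + weight R w1) w2.
Proof.
elim: w1 a => [|e w1 IH] a /=; first by rewrite /weight big_nil addr0.
by rewrite IH weight_cons addrA.
Qed.

Lemma leaves_place a d T : leaves a (tau ^+ d) T = place a (exps d T).
Proof.
elim: T a d => [|[] l IHl r IHr] a d //=;
  by rewrite place_cat weight_exps -IHl -IHr -exprD -exprS.
Qed.

Definition in_piece (t : R) (I : R * R) : bool := I.1 < t <= I.1 + I.2.

Lemma in_piece_split a K L (t : R) : 0 <= K <= L ->
  (in_piece t (a, K) + in_piece t ((a + K)%R, (L - K)%R))%N = in_piece t (a, L).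
Proof.
move=> hK; rewrite /in_piece /= addrACA subrr addr0.
by case: (ltP a t) => h1; case: (leP t (a + K)) => h2;
   case: (leP t (a + L)) => h3 //=; exfalso; lra.
Qed.

Lemma tau_mul_gt0 L : 0 < L -> 0 < tau * L /\ 0 < tau ^+ 2 * L.
Proof. by move=> L0; split; apply: mulr_gt0 => //; rewrite ?exprn_gt0 // tau_gt0. Qed.

Lemma count_leaves a (L t : R) T : 0 < L ->
  count (in_piece t) (leaves a L T) = in_piece t (a, L).
Proof.
have t2 := tau_sq R; have /andP[tl tu] := tau_bounds R; have t0 := tau_gt0 R.
elim: T a L => [|[] l IHl r IHr] a L L0 /=; first by rewrite addn0.
all: have [p1 p2] := tau_mul_gt0 L0.
  rewrite count_cat IHl ?IHr // (_ : tau * L = L - tau ^+ 2 * L).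
    by rewrite in_piece_split // t2; nra.
  by rewrite t2; ring.
rewrite count_cat IHl ?IHr // (_ : tau ^+ 2 * L = L - tau * L).
  by rewrite in_piece_split //; nra.
by rewrite t2; ring.
Qed.

Lemma leaves_gt0 a (L : R) T I : 0 < L -> I \in leaves a L T -> 0 < I.2.
Proof.
have t0 := tau_gt0 R.
elim: T a L => [|[] l IHl r IHr] a L L0 /=; first by rewrite inE => /eqP ->.
all: have [p1 p2] := tau_mul_gt0 L0.
  by rewrite mem_cat => /orP[/IHl|/IHr]; apply.
by rewrite mem_cat => /orP[/IHl|/IHr]; apply.
Qed.

Lemma leaves_sub a (L t : R) T I : 0 < L -> I \in leaves a L T ->
  in_piece t I -> in_piece t (a, L).
Proof.
move=> L0 IT tI; have := count_leaves a t T L0.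
have : (0 < count (in_piece t) (leaves a L T))%N by rewrite -has_count; apply/hasP; exists I.
by case: in_piece => // h e; move: h; rewrite e.
Qed.

(** Subdivision by a tree commutes with affine maps, so the tree grafted on a
    leaf in the domain is the one grafted on its image. *)
Lemma leaves_affine m c a (L : R) T :
  leaves (m * a + c) (m * L) T = [seq (m * J.1 + c, m * J.2) | J <- leaves a L T].
Proof.
elim: T a L => [|[] l IHl r IHr] a L //=;
  by rewrite map_cat -IHl -IHr; congr (leaves _ _ _ ++ leaves _ _ _); ring.
Qed.

Definition avoids (b : R) (D : seq (R * R)) : bool :=
  all (fun I => ~~ (I.1 < b < I.1 + I.2)) D.

(** The point [p = i + j tau] of (0,1) is followed into the half of the x-caret
    that contains it, rescaled to (0,1]. Since [tau^-1 = 1 + tau], it becomes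
    [(2 i + j) + (i + j) tau] in the left half and [(i + j) + (i - 1) tau] in the
    right half. As [i = p - j tau] with [0 < p < 1], the new coefficients of
    [tau] are [p + j tau^2] and [p - 1 - j tau], smaller than [j] in absolute
    value once [`|j|] is at least 2. The coefficient 0 would make [p] an integer,
    and 1 and -1 are the points [tau] and [tau ^ 2]. *)
Lemma avoid_point (i j : int) a d : exists2 X, only_x X &
  avoids (a + tau ^+ d * (i%:~R + j%:~R * tau)) (leaves a (tau ^+ d) X).
Proof.
have t2 := tau_sq R; have /andP[tl tu] := tau_bounds R.
have [N] := ubnP `|j|%N; elim: N i j a d => // N IH i j a d jN.
set p := i%:~R + j%:~R * tau.
have T0 : 0 < tau ^+ d by rewrite exprn_gt0 // tau_gt0.
case: (boolP (0 < p < 1)) => p01; last first.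
  exists Leaf => //=; rewrite /avoids /= andbT; apply: contra p01 => /= /andP[h1 h2].
  by apply/andP; split; nra.
have /andP[p0 p1] := p01.
have [j0|j0] := eqVneq j 0.
  exfalso; move: p0 p1; rewrite /p j0 mul0r addr0 ltr0z -[1]/(1%:~R) ltr_int; lia.
have eL : a + tau ^+ d * p = a + tau ^+ d.+2 * ((2 * i + j)%:~R + (i + j)%:~R * tau).
  rewrite -addn2 exprD -mulrA; congr (_ + _ * _).
  rewrite !rmorphD rmorphM /= /p; ring: t2.
have eR : a + tau ^+ d * p = a + tau ^+ 2 * tau ^+ d +
      tau ^+ d.+1 * ((i + j)%:~R + (i - 1)%:~R * tau).
  rewrite (exprS _ d) rmorphD rmorphB rmorph1 /= /p; move: (tau ^+ d) => T; ring: t2.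
have px : i%:~R = p - j%:~R * tau by rewrite /p; ring.
have [j1|[j1|jbig]] : j = 1 \/ j = - 1 \/ (2 <= j \/ j <= - 2) by lia.
- have i0 : i = 0.
    suff : -1 < i < 1 by lia.
    rewrite -!(ltr_int R) px j1; lra.
  (* [p] is the breakpoint of y(Leaf,Leaf), and [tau ^ 2 + tau ^ 3 = tau] makes it
     a breakpoint of x(Leaf,x(Leaf,Leaf)) as well. *)
  have pE : p = tau by rewrite /p i0 j1; ring.
  exists (Node Xcaret Leaf Xl) => //=; rewrite /avoids /= pE.
  have uT : tau ^+ d < 2 * (tau * tau ^+ d) by nra.
  have -> : tau ^+ 2 * (tau * tau ^+ d) = tau * tau ^+ d - tau ^+ 2 * tau ^+ d.
    by move: (tau ^+ d) => T; ring: t2.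
  have -> : tau ^+ 2 * tau ^+ d = tau ^+ d - tau * tau ^+ d.
    by rewrite t2; ring.
  rewrite (mulrC (tau ^+ d) tau).
  by apply/and4P; split=> //; apply/negP => /andP[h1 h2]; lra.
- have i1 : i = 1.
    suff : 0 < i < 2 by lia.
    rewrite -!(ltr_int R) px j1; lra.
  have pE : p = tau ^+ 2 by rewrite /p i1 j1 t2; ring.
  exists Xl => //=; rewrite /avoids /= pE (mulrC (tau ^+ d)).
  by apply/and3P; split=> //; apply/negP => /andP[h1 h2]; lra.
have jbigR : (2 <= j%:~R :> R) \/ (j%:~R <= - 2 :> R).
  by case: jbig => h; [left|right]; rewrite -(ler_int R) in h; lra.
have [l xl hl] : exists2 l, only_x l &
  avoids (a + tau ^+ d * p) (leaves a (tau ^+ 2 * tau ^+ d) l).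
  case: (ltP p (tau ^+ 2)) => pt; last first.
    exists Leaf => //; rewrite /avoids /= andbT; apply/negP; nra.
  rewrite eL -exprD; apply: (IH (2 * i + j) (i + j)).
  suff : - j < i + j < j \/ j < i + j < - j by lia.
  rewrite -!(ltr_int R) (rmorphN intr) (rmorphD intr) /= px.
  by case: jbigR => ?; [left|right]; nra.
have [r xr hr] : exists2 r, only_x r &
  avoids (a + tau ^+ d * p) (leaves (a + tau ^+ 2 * tau ^+ d) (tau * tau ^+ d) r).
  case: (ltP (tau ^+ 2) p) => pt; last first.
    exists Leaf => //; rewrite /avoids /= andbT; apply/negP; nra.
  rewrite eR -exprS; apply: (IH (i + j) (i - 1)).
  suff : - j < i - 1 < j \/ j < i - 1 < - j by lia.
  rewrite -!(ltr_int R) (rmorphN intr) (rmorphB intr) /= px.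
  by case: jbigR => ?; [left|right]; nra.
by exists (Node Xcaret l r) => //=; rewrite /avoids all_cat; apply/andP.
Qed.

(** Z[tau] in the basis [1, tau], available because [tau ^ 2 = 1 - tau]. *)
Definition Zpt (x : R) : Prop := exists i j : int, x = i%:~R + j%:~R * tau.

Lemma Ztau_Zpt x : Ztau x -> Zpt x.
Proof.
have t2 := tau_sq R.
move=> [p ->]; elim/poly_ind: p => [|p c [i [j e]]].
  by exists 0, 0; rewrite rmorph0 horner0 mul0r addr0.
exists (j + c), (i - j); rewrite rmorphD rmorphM /= map_polyX map_polyC /= hornerMXaddC e.
rewrite (rmorphB intr) (rmorphD intr) /=; ring: t2.
Qed.

Lemma ZptB x y : Zpt x -> Zpt y -> Zpt (x - y).
Proof.
move=> [i [j ->]] [k [l ->]]; exists (i - k), (j - l).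
rewrite !(rmorphB intr) /=; ring.
Qed.

Lemma ZptMtau x : Zpt x -> Zpt (tau * x).
Proof.
have t2 := tau_sq R.
move=> [i [j ->]]; exists j, (i - j); rewrite (rmorphB intr) /=; ring: t2.
Qed.

Lemma ZptD x y : Zpt x -> Zpt y -> Zpt (x + y).
Proof.
move=> [i [j ->]] [k [l ->]]; exists (i + k), (j + l).
rewrite !(rmorphD intr) /=; ring.
Qed.

Lemma Zpt_exp d : Zpt (tau ^+ d).
Proof.
elim: d => [|d IH]; first by exists 1, 0; rewrite expr0 mul0r addr0.
by rewrite exprS; exact: ZptMtau.
Qed.

(** [tau] is a unit of Z[tau], with inverse [1 + tau]. *)
Lemma Zpt_div d x : Zpt x -> exists2 y, Zpt y & x = tau ^+ d * y.
Proof.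
have t2 := tau_sq R.
elim: d x => [|d IH] x hx; first by exists x; rewrite ?mul1r.
have [y [i [j ->]] ->] := IH _ hx.
exists ((i + j)%:~R + i%:~R * tau); first by exists (i + j), i.
rewrite (rmorphD intr) exprS /=; move: (tau ^+ d) => T; ring: t2.
Qed.

Lemma avoid_Zpt b a d : Zpt a -> Zpt b ->
  exists2 X, only_x X & avoids b (leaves a (tau ^+ d) X).
Proof.
move=> ha hb; have [_ [i [j ->]] e] := Zpt_div d (ZptB hb ha).
by have := avoid_point i j a d; rewrite -e addrC subrK.
Qed.

(** A point [b] inside a leaf is inside the root: two points of the leaf on
    either side of [b] lie in the half-open root interval. *)
Lemma avoids_sub b a (L : R) T : 0 < L -> ~~ (a < b < a + L) -> avoids b (leaves a L T).
Proof.
move=> L0 ab; apply/allP => I IT; apply: contra ab => /andP[h1 h2].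
have i1 : in_piece ((I.1 + b) / 2) I by rewrite /in_piece; apply/andP; split; lra.
have i2 : in_piece (I.1 + I.2) I.
  by rewrite /in_piece lexx andbT ltrDl (leaves_gt0 L0 IT).
have := leaves_sub L0 IT i1; have := leaves_sub L0 IT i2; rewrite /in_piece /= => i3 i4.
lra.
Qed.

(** The breakpoints of [s] are removed inside each leaf of [X]; by [avoids_sub]
    this cannot undo what [X] already achieves. *)
Lemma avoid_refine a d (s : seq R) X :
  (forall a' d', Zpt a' ->
    exists2 Y, only_x Y & all (avoids^~ (leaves a' (tau ^+ d') Y)) s) ->
  Zpt a -> only_x X ->
  exists Y, [/\ only_x Y, all (avoids^~ (leaves a (tau ^+ d) Y)) s &
    forall b, avoids b (leaves a (tau ^+ d) X) -> avoids b (leaves a (tau ^+ d) Y)].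
Proof.
move=> H; elim: X a d => [|c l IHl r IHr] a d ha.
  move=> _; have [Y xY hY] := H a d ha; exists Y; split=> // b.
  by rewrite /avoids /= andbT => hb; apply: avoids_sub; rewrite ?exprn_gt0 ?tau_gt0.
move=> [-> xl xr].
have [l' [xl' sl al]] := IHl a d.+2 ha xl.
have [r' [xr' sr ar]] := IHr (a + tau ^+ d.+2) d.+1 (ZptD ha (Zpt_exp _)) xr.
exists (Node Xcaret l' r'); rewrite /= -exprD -exprS; split=> //.
  apply/allP => b bs; rewrite /avoids all_cat; apply/andP.
  by split; [apply: (allP sl)|apply: (allP sr)].
move=> b; rewrite /avoids !all_cat => /andP[h1 h2]; apply/andP.
by split; [exact: al|exact: ar].
Qed.

Lemma avoid_all (s : seq R) a d : (forall b, b \in s -> Zpt b) -> Zpt a ->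
  exists2 X, only_x X & all (avoids^~ (leaves a (tau ^+ d) X)) s.
Proof.
elim: s a d => [|b s IH] a d hs ha; first by exists Leaf.
have hb : Zpt b by apply: hs; rewrite mem_head.
have {}hs c : c \in s -> Zpt c by move=> cs; apply: hs; rewrite inE cs orbT.
have [X xX bX] := avoid_Zpt d ha hb.
have [Y [xY sY bY]] := avoid_refine d (fun a' d' => @IH a' d' hs) ha xX.
by exists Y; rewrite //= bY.
Qed.

Lemma piece_of (s : seq R) x a L : 0 < L -> path <%R x s -> x <= a ->
  a < last x s -> (forall b, b \in s -> ~~ (a < b < a + L)) ->
  exists i, [/\ (i < size s)%N, nth 0 (x :: s) i <= a & a + L <= nth 0 (x :: s) i.+1].
Proof.
move=> L0; elim: s x => [|b s IH] x /=; first by move=> _ h1 h2; lra.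
move=> /andP[xb pb] xa al hs.
case: (ltP a b) => ab.
  exists 0%N; split=> //=; have := hs b (mem_head _ _); rewrite ab /=.
  by rewrite -leNgt.
have [|i [h1 h2 h3]] := IH b pb ab al; first by move=> c cs; apply: hs; rewrite inE cs orbT.
by exists i.+1.
Qed.

(** A partition of (a, b] is expressed by counting, which makes removing an
    interval a subtraction. Because the intervals contain their right ends, the
    one that contains [b] ends at [b]; what remains partitions (a, J.1]. *)
Lemma partition_place (D : seq (R * R)) (a b : R) : a <= b ->
  (forall I, I \in D -> exists e, I.2 = tau ^+ e) ->
  (forall t, count (in_piece t) D = (a < t <= b)) ->
  exists2 w, perm_eq D (place a w) & a + weight R w = b.
Proof.
have [n] := ubnP (size D); elim: n D b => // n IH D b sD ab hD cD.
have gt0 I : I \in D -> 0 < I.2 by move=> /hD[e ->]; rewrite exprn_gt0 ?tau_gt0.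
have mem I t : I \in D -> in_piece t I -> a < t <= b.
  move=> ID tI; have : (0 < count (in_piece t) D)%N by rewrite -has_count; apply/hasP; exists I.
  by rewrite cD; case: (_ < _ <= _).
have [ab'|] := ltP a b; last first.
  move=> ba; have eab : a = b by apply/eqP; rewrite eq_le ab ba.
  case: D {sD IH} hD cD gt0 mem => [|I D] hD cD gt0 mem.
    by exists [::] => //=; rewrite /weight big_nil addr0.
  have I0 := gt0 I (mem_head _ _).
  have := mem I (I.1 + I.2) (mem_head _ _); rewrite /in_piece => /(_ _)/andP[|]; lra.
have : has (in_piece b) D by rewrite has_count cD ab' lexx.
move=> /hasP[J JD /andP[J1 J2]].
have J0 := gt0 _ JD.
have /andP[Ja Jb] : a < J.1 + J.2 <= b.
  by apply: (mem _ _ JD); rewrite /in_piece lexx ltrDl J0.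
have eb : b = J.1 + J.2 by apply/eqP; rewrite eq_le J2 Jb.
have aJ : a <= J.1.
  rewrite leNgt; apply/negP => Ja'.
  have : a < a <= b by apply: (mem _ _ JD); rewrite /in_piece Ja' ltW.
  by rewrite ltxx.
have pD := perm_to_rem JD.
have [||||w pw ew] := IH (rem J D) J.1.
- by rewrite size_rem //; case: (D) JD sD.
- by [].
- by move=> I /mem_rem; exact: hD.
- have rel c t : in_piece t (a, c - a) = (a < t <= c) by rewrite /in_piece /= subrKC.
  move=> t; have := @in_piece_split a (J.1 - a) (b - a) t; rewrite !rel subrKC.
  have -> : b - a - (J.1 - a) = J.2 by rewrite eb; ring.
  rewrite subr_ge0 aJ lerB ?(ltW J1) // -surjective_pairing => /(_ isT).
  by rewrite -cD (seq.permP pD) /= addnC => /addnI <-.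
have [e Je] := hD _ JD.
exists (rcons w e); last by rewrite -cats1 weight_cat addrA ew /weight big_seq1 -Je.
rewrite -cats1 place_cat ew /= -Je -surjective_pairing.
by rewrite perm_sym cats1 perm_rcons perm_sym (permPl pD) perm_cons.
Qed.

End Points.

(** * From an element of Vtau to a pair of trees *)

Section Assembly.
Variable R : realType.
Local Notation tau := (tau R).
Local Notation ival := (R * R)%type.

Fixpoint graft_leaves (D : seq ival) (Xs : seq tree) : seq ival :=
  match D, Xs with
  | J :: D', X :: Xs' => leaves J.1 J.2 X ++ graft_leaves D' Xs'
  | _, _ => [::]
  end.

Lemma place_refine a w Xs : size Xs = size w ->
  place a (refine w Xs) = graft_leaves (place a w) Xs.
Proof.
elim: w a Xs => [|n w IH] a [|X Xs] //= [sz].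
by rewrite place_cat weight_exps IH // leaves_place.
Qed.

Lemma leaves_place0 T : leaves 0 (1 : R) T = place 0 (exps 0 T).
Proof. by rewrite -(expr0 tau) leaves_place. Qed.

(** The pair [q] is the affine map [x |-> q.1 * x + q.2]. *)
Definition affine_on (f : R -> R) (I q : ival) : Prop :=
  [/\ 0 < q.1, 0 < I.2 & forall x, in_piece x I -> f x = q.1 * x + q.2].

Definition img (p : ival * ival) : ival := (p.2.1 * p.1.1 + p.2.2, p.2.1 * p.1.2).

Lemma affine_on_sub f (I q J : ival) X : affine_on f I q -> J \in leaves I.1 I.2 X ->
  affine_on f J q.
Proof.
move=> [q0 I0 fI] JI; split=> //; first exact: leaves_gt0 JI.
by move=> x xJ; apply: fI; have := leaves_sub I0 JI xJ; rewrite -surjective_pairing.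
Qed.

Lemma in_piece_img t x (p : ival * ival) : 0 < p.2.1 -> t = p.2.1 * x + p.2.2 ->
  in_piece t (img p) = in_piece x p.1.
Proof.
move=> q0 ->; rewrite /in_piece /= addrAC -mulrDr ltrD2r lerD2r.
by rewrite ltr_pM2l // ler_pM2l.
Qed.

Lemma affine_on_incr f (p : ival * ival) : affine_on f p.1 p.2 ->
  incr_affine_onto f (fun x => in_piece x p.1) (fun x => in_piece x (img p)).
Proof.
move=> [q0 I0 fI]; split; first by exists p.2.1, p.2.2.
apply/seteqP; split=> [_ [x xI <-]|t tI] /=.
  by rewrite (in_piece_img (x := x)) // fI.
exists ((t - p.2.2) / p.2.1); last first.
  rewrite fI; first by field; rewrite lt0r_neq0.
  by rewrite -(in_piece_img (t := t)) //; field; rewrite lt0r_neq0.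
by rewrite /= -(in_piece_img (t := t)) //; field; rewrite lt0r_neq0.
Qed.

Lemma leaf_intervalE T i :
  @leaf_interval R T i = (fun x => in_piece x (nth (0, 0) (leaves 0 1 T) i)).
Proof.
rewrite /leaf_interval; case: (nth _ _ _) => a L.
by apply/funext => x; rewrite /in_piece /= in_itv.
Qed.

(** Left continuity gives the value at the right end of a piece, which the
    definition of piecewise linearity leaves open. *)
Lemma affine_closed (f : R -> R) (a L m c : R) : 0 < L ->
  (f x @[x --> (a + L)^'-] --> f (a + L)) ->
  (forall x, a < x < a + L -> f x = m * x + c) ->
  forall x, a < x <= a + L -> f x = m * x + c.
Proof.
move=> L0 fc fI x /andP[ax]; rewrite le_eqVlt => /orP[/eqP ->|xl]; last first.
  by apply: fI; rewrite ax xl.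
have h : (m * x + c) @[x --> (a + L)^'-] --> m * (a + L) + c.
  apply: cvg_at_left_filter; apply: cvgD; last exact: cvg_cst.
  by apply: cvgM; [exact: cvg_cst|exact: cvg_id].
apply: (cvg_unique _ fc _); first exact: norm_hausdorff.
apply: cvg_trans h.
apply: near_eq_cvg; near=> y; apply/esym; apply: fI.
apply/andP; split; near: y; last exact: nbhs_left_lt.
by apply: nbhs_left_gt; rewrite ltrDl.
Unshelve. all: by end_near.
Qed.

Lemma choose_seq (A B : eqType) (P : A -> B -> Prop) (D : seq A) :
  (forall x, x \in D -> exists b, P x b) ->
  exists E : seq (A * B), unzip1 E = D /\ forall p, p \in E -> P p.1 p.2.
Proof.
elim: D => [|x D IH] h; first by exists [::].
have [b xb] := h x (mem_head _ _).
have [|E [<- hE]] := IH; first by move=> y yD; apply: h; rewrite inE yD orbT.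
by exists ((x, b) :: E); split=> // p; rewrite inE => /orP[/eqP ->|/hE].
Qed.

(** On a leaf without breakpoints inside, [v] is given by a single formula. *)
Lemma Vtau_x_tree v : @Vtau R v -> exists2 X, only_x X &
  exists E : seq (ival * ival), unzip1 E = leaves 0 1 X /\
   forall p, p \in E -> affine_on v p.1 p.2 /\ exists n : int, p.2.1 = tau ^ n.
Proof.
move=> [_ vc [s [ps ls zs hs]]].
have [|X xX aX] := @avoid_all R s 0 0 (fun b hb => Ztau_Zpt (zs b hb)).
  by exists 0, 0; rewrite mul0r addr0.
rewrite expr0 in aX; exists X => //.
have hl I : I \in leaves 0 1 X ->
    exists q : ival, affine_on v I q /\ exists n : int, q.1 = tau ^ n.
  move=> IX; have I0 := leaves_gt0 ltr01 IX.
  have top : in_piece (I.1 + I.2) I by rewrite /in_piece lexx ltrDl I0.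
  have /andP[] := leaves_sub ltr01 IX top; rewrite /= add0r => e0 e1.
  have b0 : 0 <= I.1.
    rewrite leNgt; apply/negP => neg.
    have : in_piece 0 I by rewrite /in_piece neg ltW.
    by move=> /(leaves_sub ltr01 IX)/andP[]; rewrite ltxx.
  have avs b : b \in s -> ~~ (I.1 < b < I.1 + I.2).
    by move=> bs; exact: (allP (allP aX b bs) I IX).
  have [|i [isz h1 h2]] := piece_of I0 ps b0 _ avs; first by rewrite ls; lra.
  have [n [c hc]] := hs i isz.
  exists (tau ^ n, c); split; last by exists n.
  split=> //=; first by rewrite exprz_gt0 ?tau_gt0.
  apply: affine_closed => //; first by apply: vc; rewrite e0 e1.
  by move=> x /andP[x1 x2]; apply: hc; apply/andP; split; lra.
by have [E [h1 h2]] := choose_seq hl; exists E.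
Qed.

(** The intervals onto which a bijection maps the leaves of a tree partition
    (0,1] as the leaves do. *)
Lemma count_images v (E : seq (ival * ival)) T : @Vtau R v -> unzip1 E = leaves 0 1 T ->
  (forall p, p \in E -> affine_on v p.1 p.2) ->
  forall t, count (in_piece t) (map img E) = (0 < t <= 1).
Proof.
move=> [[vfun vinj vsurj] _ _] ET hE t.
have sub p x : p \in E -> in_piece x p.1 -> 0 < x <= 1.
  move=> pE xp; have : p.1 \in leaves 0 1 T by rewrite -ET; apply: map_f.
  by move=> /(leaves_sub ltr01) => /(_ _ xp); rewrite /in_piece /= add0r.
have pre p : p \in E -> in_piece t (img p) -> exists2 x, in_piece x p.1 & v x = t.
  move=> pE tp; have [_ e] := affine_on_incr (hE _ pE).
  by have : (v @` (fun x => in_piece x p.1)) t by rewrite e.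
case: (boolP (0 < t <= 1)) => t01; last first.
  apply/eqP; rewrite -leqn0 leqNgt -has_count; apply: contra t01 => /hasP[q].
  move=> /mapP[p pE ->] /(pre _ pE)[x xp <-].
  have := vfun x; rewrite /= !in_itv /=; apply; exact: sub xp.
have [x] : (v @` `]0, 1]) t by apply: vsurj; rewrite /= in_itv.
rewrite /= in_itv /= => x01 vx.
rewrite count_map (eq_in_count (a2 := preim fst (in_piece x))); last first.
  move=> p pE /=; apply/idP/idP => [/(pre _ pE)[y yp vy]|xp].
    rewrite (_ : x = y) //; apply: vinj; rewrite ?inE /= ?in_itv ?vy //=.
    exact: sub yp.
  have [p0 _ fp] := hE _ pE.
  by rewrite (in_piece_img (x := x)) // -vx fp.
by rewrite -count_map -/(unzip1 E) ET count_leaves // /in_piece /= add0r x01.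
Qed.

Lemma tau_exp_nat (n : int) : tau ^ n <= 1 -> exists e : nat, tau ^ n = tau ^+ e.
Proof.
have /andP[tl tu] := tau_bounds R.
case: n => [e _|e]; first by exists e.
rewrite NegzE -exprnN => h; exfalso; move: h; rewrite leNgt => /negP; apply.
by rewrite invf_gt1 ?exprn_gt0 ?tau_gt0 // exprn_ilt1 //; lra.
Qed.

(** Each interval carries its affine map, so that the leaves in the domain and
    their images are refined together and the matching between them is kept. *)
Fixpoint graft_pairs (E : seq (ival * ival)) (Xs : seq tree) : seq (ival * ival) :=
  match E, Xs with
  | p :: E', X :: Xs' =>
      [seq (J, p.2) | J <- leaves p.1.1 p.1.2 X] ++ graft_pairs E' Xs'
  | _, _ => [::]
  end.

Lemma unzip1_graft_pairs E Xs : unzip1 (graft_pairs E Xs) = graft_leaves (unzip1 E) Xs.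
Proof.
elim: E Xs => [|p E IH] [|X Xs] //=.
by rewrite /unzip1 map_cat -map_comp map_id; congr (_ ++ _); exact: IH.
Qed.

Lemma img_graft_pairs E Xs : map img (graft_pairs E Xs) = graft_leaves (map img E) Xs.
Proof.
elim: E Xs => [|p E IH] [|X Xs] //=.
by rewrite map_cat -map_comp IH leaves_affine.
Qed.

Lemma affine_graft_pairs f E Xs : (forall p, p \in E -> affine_on f p.1 p.2) ->
  forall p, p \in graft_pairs E Xs -> affine_on f p.1 p.2.
Proof.
elim: E Xs => [|p E IH] [|X Xs] //= hE q.
rewrite mem_cat => /orP[/mapP[J JX ->]|].
  by apply: affine_on_sub JX; apply: hE; rewrite mem_head.
by apply: IH => r rE; apply: hE; rewrite inE rE orbT.
Qed.

Lemma graft_leaves_map (T : Type) (g : T -> ival) (h : T -> tree) (s : seq T) :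
  graft_leaves (map g s) (map h s) = flatten [seq leaves (g i).1 (g i).2 (h i) | i <- s].
Proof. by elim: s => //= i s ->. Qed.

Lemma perm_graft_leaves (D : seq ival) Xs (Is : seq nat) :
  size Xs = size D -> perm_eq Is (iota 0 (size D)) ->
  perm_eq (graft_leaves (map (nth (0, 0) D) Is) (map (nth Leaf Xs) Is)) (graft_leaves D Xs).
Proof.
move=> sz pI; rewrite -{2}(mkseq_nth (0, 0) D) -{2}(mkseq_nth Leaf Xs) /mkseq sz.
by rewrite !graft_leaves_map; apply: perm_flatten; apply: perm_map.
Qed.

Lemma size_place (a : R) w : size (place a w) = size w.
Proof. by elim: w a => //= e w IH a; rewrite IH. Qed.

Lemma place_mem (a : R) w J : J \in place a w -> exists e, J.2 = tau ^+ e.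
Proof.
by elim: w a => //= e w IH a; rewrite inE => /orP[/eqP ->|/IH //]; exists e.
Qed.

Lemma Forall_trees_nth (P : tree -> Prop) Xs Is : P Leaf -> Forall_trees P Xs ->
  Forall_trees P (map (nth Leaf Xs) Is).
Proof.
move=> PL hX; elim: Is => //= i Is IH; split=> //.
by elim: Xs i hX {IH} => [|X Xs IH] [|i] //= [hX hXs] //; exact: IH.
Qed.

(** The list [Q] holds the leaves of T2 from left to right, each with the affine
    map that [v] is on it. *)
Lemma common_refinement v : @Vtau R v -> exists T1 T2 (Q : seq (ival * ival)),
  [/\ y_left_leaf T1, only_x T2, unzip1 Q = leaves 0 1 T2,
     perm_eq (map img Q) (leaves 0 1 T1) & forall p, p \in Q -> affine_on v p.1 p.2].
Proof.
move=> hv; have [X xX [E [EX hE]]] := Vtau_x_tree hv.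
have hA p pE := (hE p pE).1.
have cE := count_images hv EX hA.
have [J /mapP[p pE ->]|//|w pw w1] := @partition_place R (map img E) 0 1 ler01.
  have [[q0 I0 _] [n qn]] := hE p pE.
  have [d Id] : exists d, p.1.2 = tau ^+ d.
    by apply: (@place_mem 0 (exps 0 X)); rewrite -leaves_place0 -EX map_f.
  have K0 : 0 < (img p).2 by rewrite /= mulr_gt0.
  (* An image inside (0,1] has length at most 1, so its exponent is nonnegative. *)
  have [e en] : exists e : nat, tau ^ (n + d%:Z) = tau ^+ e.
    apply: tau_exp_nat; rewrite expfzDr ?lt0r_neq0 ?tau_gt0 // -qn -exprnP -Id.
    have mem t : in_piece t (img p) -> 0 < t <= 1.
      move=> tp; have : (0 < count (in_piece t) (map img E))%N.
        by rewrite -has_count; apply/hasP; exists (img p); rewrite ?map_f.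
      by rewrite cE; case: (_ < _ <= _).
    have top : in_piece ((img p).1 + (img p).2) (img p) by rewrite /in_piece lexx ltrDl K0.
    have /andP[t0 t1] := mem _ top.
    have c0 : 0 <= (img p).1.
      rewrite leNgt; apply/negP => neg.
      have /mem/andP[] : in_piece 0 (img p) by rewrite /in_piece neg ltW.
      by rewrite ltxx.
    by move: t1 c0; rewrite /=; lra.
  by exists e; rewrite /= Id qn -en expfzDr // lt0r_neq0 ?tau_gt0.
rewrite add0r in w1.
have [T1 hT1 [Xs [sXs xXs eXs]]] := refines_y_left_leaf w1.
have [Is pI eI] := perm_iotaP (0, 0) pw.
have sE : size E = nleaves X by rewrite -(size_exps 0) -(size_place 0) -leaves_place0 -EX size_map.
have sI : size Is = size E by rewrite -(size_map img) eI size_map.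
pose Ys := map (nth Leaf Xs) Is.
have [T2 [eT2 xT2]] : exists T', (forall d, exps d T' = refine (exps d X) Ys) /\
    (only_x X -> Forall_trees only_x Ys -> only_x T').
  by apply: graft; rewrite size_map sI sE.
exists T1, T2, (graft_pairs E Ys); split=> //.
- by apply: xT2 => //; exact: Forall_trees_nth.
- rewrite unzip1_graft_pairs EX !leaves_place0 eT2 place_refine //.
  by rewrite size_exps size_map sI sE.
- rewrite img_graft_pairs eI leaves_place0 eXs place_refine //.
  by apply: perm_graft_leaves => //; rewrite size_place.
exact: affine_graft_pairs.
Qed.
End Assembly.

Theorem lemma1p1 (R : realType) (v : R -> R) (hv : @Vtau R v) :
  exists (k : nat) (T1 T2 : tree) (p : 'S_k),
    [/\ nleaves T1 = k /\ nleaves T2 = k,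
        represents T1 p T2 v,
        only_x T2 &
        y_left_leaf T1].
Proof.
have [T1 [T2 [Q [hT1 hT2 Q2 Q1 hQ]]]] := common_refinement hv.
have size_leaves T : size (leaves 0 (1 : R) T) = nleaves T.
  by rewrite leaves_place0 size_place size_exps.
have sQ1 : size Q = nleaves T1 by rewrite -size_leaves -(perm_size Q1) size_map.
have sQ2 : size Q = nleaves T2 by rewrite -size_leaves -Q2 size_map.
have sT1 : size (leaves 0 (1 : R) T1) == nleaves T1 by rewrite size_leaves.
have /tuple_permP[p ep] : perm_eq (map (@img R) Q) (Tuple sT1) by [].
exists (nleaves T1), T1, T2, p; split=> //; first by rewrite -sQ1 sQ2.
move=> i; rewrite !leaf_intervalE.
have iQ : (i < size Q)%N by rewrite sQ1.
have -> : nth (0, 0) (leaves 0 1 T2) i = (nth ((0, 0), (0, 0)) Q i).1.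
  by rewrite -Q2 (nth_map ((0, 0), (0, 0))).
have -> : nth (0, 0) (leaves 0 1 T1) (p i) = img (nth ((0, 0), (0, 0)) Q i).
  rewrite -(nth_map _ (0, 0)) // ep -tnth_nth tnth_mktuple.
  by rewrite (tnth_nth (0, 0)).
by apply: affine_on_incr; apply: hQ; exact: mem_nth.
Qed.
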